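(* Let $k,t,m\in\mathbb{N}$. For each $j\in\{1,\dots,t\}$ let $A_j\subset\mathbb{N}^k$ be a piecewise syndetic set and, for each $i\in\{1,\dots,k\}$, let $a_i^{(j)}\in\mathbb{Z}[x]$ with $a_i^{(j)}(0)=0$ and let $b_i^{(j)}(n)=\left\lfloor a_i^{(j)}\big(n^{1/m}\big)\right\rfloor$. Then there exists $n\in\mathbb{N}$ such that for each $j\in\{1,\dots,t\}$ there exists $x_j\in\mathbb{N}^k$ such that $$\Big\{x_j+b_i^{(j)}(n)\cdot e_i:i\in\{1,\dots,k\}\Big\}\subset A_j,$$ where $e_1,\dots,e_k$ are the canonical basis vectors.
   Context: $\mathbb{N}=\{1,2,\dots\}$, and $\mathbb{N}^k$ is regarded as a semigroup under addition; $e_i$ is the vector with $i$-th coordinate $1$ and all others $0$. A set $S\subset\mathbb{N}^k$ is syndetic if there is a finite set $F\subset\mathbb{N}^k$ such that every $g\in\mathbb{N}^k$ satisfies $x+g\in S$ for some $x\in F$. A set is thick if it has non-empty intersection with every syndetic set. A set is piecewise syndetic if it is the intersection of a syndetic set and a thick set. *)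

(* Defs.v *)
From mathcomp Require Import all_boot all_order all_algebra.
From mathcomp Require Import boolp classical_sets functions cardinality.

Set Implicit Arguments.
Unset Strict Implicit.
Unset Printing Implicit Defensive.

Import Order.TTheory GRing.Theory Num.Theory.
Local Open Scope classical_set_scope.
Local Open Scope ring_scope.

(* N^k with N = {1, 2, ...}, as the positive vectors of Z^k: shifts by
   possibly negative multiples of the basis vectors then make sense. *)
Definition Npow (k : nat) : set 'rV[int]_k :=
  [set x | forall i, 0 < x 0 i].
Arguments Npow : clear implicits.

Definition syndetic (k : nat) (S : set 'rV[int]_k) : Prop :=
  S `<=` Npow k /\
  exists F : set 'rV[int]_k,
    [/\ finite_set F, F `<=` Npow k &
        forall g, Npow k g -> exists2 x, F x & S (x + g)].

Definition thick (k : nat) (T : set 'rV[int]_k) : Prop :=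
  T `<=` Npow k /\ forall S, syndetic S -> T `&` S !=set0.

Definition piecewise_syndetic (k : nat) (A : set 'rV[int]_k) : Prop :=
  exists S T, [/\ syndetic S, thick T & A = S `&` T].

(* Main.v *)
Require Import Defs.
From mathcomp Require Import all_boot all_order all_algebra.
From mathcomp Require Import boolp classical_sets functions cardinality reals exp.
From mathcomp Require Import ring.

Set Implicit Arguments.
Unset Strict Implicit.
Unset Printing Implicit Defensive.

Import Order.TTheory GRing.Theory Num.Theory.
Local Open Scope classical_set_scope.
Local Open Scope ring_scope.

(** At a perfect power n = r ^ m the root disappears: floor (a (n^(1/m))) = a (r).
So it suffices to find r for polynomial configurations x_j + a_i^(j)(r) e_i, and
this is a consequence of the multidimensional polynomial van der Waerden
theorem, as follows.

A piecewise syndetic set A comes with a finite palette F such that every finite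
configuration P has a translate all of whose points are moved into A by some
f in F ([piecewise_syndetic_cover]). Choosing such an f for each point colours P
with #|F| colours, and a monochromatic subset of P, moved by its common f, lies
in A. To use a single r for all the sets A_j, colour the product of t copies of
Z^k by the t-tuple of these colours, and look for a monochromatic
{x + q_i(r)} with q_i = sum_j a_i^(j) e_(j,i): its projection to the j-th copy is
the configuration wanted in A_j. Since the palettes are fixed but the colouring
depends on P, the van der Waerden theorem is needed in its finitary form [vdw].

The polynomial van der Waerden theorem ([polynomial_vdw]) is proved for
polynomials over an arbitrary commutative ring, which serves here as an
environment for Z^(t k): the ring {poly {poly int}} contains a copy of it, with
the coefficients as coordinates. The proof is Walters' colour focusing. Given
p in A, the theorem for the polynomials q(X + d) - q(d) - p(X), with q in A and
d bounded, applied to the colouring of x by the pattern around x, turns a point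
at which r colours are focused into a point at which r + 1 colours are focused
([color_focusing]); this must stop when the colours are exhausted. If p has
minimal degree in A, the new family is smaller than A in the PET order: the
number of distinct leading coefficients in degree deg p drops, and it does not
grow in higher degrees ([weight_derived_lt], [weight_derived_gt]). *)

(** * A well-founded order on weight functions *)

(** The lexicographic order in which higher indices weigh more is well-founded
on functions restricted to a bounded range. Asking only for <= above the index
of strict decrease spares the users a proof of equality. *)
Lemma dominance_ind (D : nat) (Q : (nat -> nat) -> Prop) :
  (forall w, (forall w', (exists2 r, (r < D)%N &
       (w' r < w r)%N /\ forall i, (r < i < D)%N -> (w' i <= w i)%N) -> Q w') ->
     Q w) ->
  forall w, Q w.
Proof.
elim: D Q => [|D IH] Q step w; first by apply: step => w' [].
have [m] := ubnP (w D); elim: m w => // m IHm w; rewrite ltnS => wm.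
have [e ew] : exists e, w D = e by exists (w D).
suff : (w D <= e)%N -> Q w by apply; rewrite ew.
rewrite ew in wm.
elim/IH: w {ew} => w IHw we; apply: step => w' [r rD [lt_r le_i]].
have [eqrD|neD] := eqVneq r D.
  by apply: IHm; apply: leq_trans wm; apply: leq_trans we; rewrite -eqrD.
have ltrD : (r < D)%N by rewrite ltn_neqAle neD -ltnS.
have lewD : (w' D <= w D)%N by apply: le_i; rewrite ltrD /=.
apply: IHw; last exact: leq_trans we.
exists r => //; split=> // i /andP[ri iD]; apply: le_i.
by rewrite ri ltnW.
Qed.

(** * The polynomial van der Waerden theorem *)

Section PolynomialVdW.
Variable R : comNzRingType.
Implicit Types (p q : {poly R}) (A : seq {poly R}).

(** Finitary form: the base point and the difference are taken from finite sets
that depend on the set of colours but not on the colouring. Quantifying over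
colourings of the whole ring keeps this form invariant under translation, with
no boxes to keep track of. *)
Definition vdw A := forall K : finType, exists F : seq R, exists N : nat,
  forall c : R -> K, exists2 x, x \in F & exists2 n, (0 < n <= N)%N &
    forall q, q \in A -> c (x + q.[n%:R]) = c x.

(** If x has the same surroundings as x + (derived p q d)(n), then moving the
base point x to x - p(n) and the difference d to d + n changes nothing for q:
x - p(n) + q(d + n) is x + (derived p q d)(n) + q(d). *)
Definition derived p q (d : nat) : {poly R} :=
  (q \Po ('X + d%:R%:P)) - q.[d%:R]%:P - p.

Definition derived_family p A (M : nat) :=
  [seq derived p q d | q <- A, d <- iota 0 M.+1].

Lemma horner_derived p q d x :
  (derived p q d).[x] = q.[x + d%:R] - q.[d%:R] - p.[x].
Proof. by rewrite /derived !hornerE horner_comp !hornerE. Qed.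

(** The point x is a focus for the colours in C: each of them is the colour of
all x + q(d) for some d, and c x is not one of them. To gain a colour, choose n
so that no pattern around x changes under translation by a g(n) with g derived:
then x - p(n) keeps the old colours, with differences d + n, and sees the colour
of x itself with difference n. If x - p(n) has one of these colours, a
monochromatic configuration is found. *)
Lemma color_focusing p A : (forall q, q \in A -> q.[0] = 0) ->
  (forall M, vdw (derived_family p A M)) ->
  forall (K : finType) (r : nat), exists F : seq R, exists N : nat,
  forall c : R -> K, exists2 x, x \in F &
    (exists2 n, (0 < n <= N)%N & forall q, q \in A -> c (x + q.[n%:R]) = c x) \/
    exists C : {set K}, [/\ #|C| = r, c x \notin C & forall z, z \in C ->
      exists2 d, (0 < d <= N)%N & forall q, q \in A -> c (x + q.[d%:R]) = z].
Proof.
move=> A0 vdwA' K; elim=> [|r [F [N FN]]].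
  exists [:: 0], 0%N => c; exists 0; first by rewrite inE.
  by right; exists finset.set0; rewrite cards0 inE; split=> // z; rewrite inE.
(* All the points at which the induction hypothesis may look at the colouring;
   the block colouring below records the colours of the points x + y, y in L. *)
pose L := F ++ [seq x + y | x <- F,
                       y <- [seq q.[d%:R] | q <- A, d <- iota 0 N.+1]].
have [F' [N' F'N']] := vdwA' N {ffun 'I_(size L) -> K}.
exists ([seq s + x | s <- F', x <- F] ++
        [seq sx - y | sx <- [seq s + x | s <- F', x <- F],
                      y <- [seq p.[n%:R] | n <- iota 0 N'.+1]]), (N + N')%N => c.
have [s sF' [n /andP[n0 nN'] eqc']] :=
  F'N' (fun x => [ffun i : 'I_(size L) => c (x + L`_i)]).
have eqc q d y : q \in A -> (d <= N)%N -> y \in L ->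
    c (s + (derived p q d).[n%:R] + y) = c (s + y).
  move=> qA dN yL.
  have yL' : (index y L < size L)%N by rewrite index_mem.
  have qdA' : derived p q d \in derived_family p A N.
    by apply: allpairs_f => //; rewrite mem_iota ltnS.
  have := congr1 (fun g : {ffun _ -> K} => g (Ordinal yL')) (eqc' _ qdA').
  by rewrite !ffunE /= nth_index.
have [x xF [[d dN mono]|[C [rC cxC focus]]]] := FN (fun x => c (s + x)).
  exists (s + x); first by rewrite mem_cat allpairs_f.
  left; exists d => [|q /mono]; last by rewrite addrA.
  by case/andP: dN => -> dN; apply: leq_trans dN (leq_addr _ _).
have focus' z : z \in c (s + x) |: C -> exists2 d, (0 < d <= N + N')%N &
    forall q, q \in A -> c (s + x - p.[n%:R] + q.[d%:R]) = z.
  rewrite finset.in_setU1 => /orP[/eqP->|/focus[d /andP[d0 dN] cd]].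
    exists n => [|q qA]; first by rewrite n0 (leq_trans nN') ?leq_addl.
    rewrite -(eqc q 0%N) // ?mem_cat ?xF // horner_derived addr0 A0 //.
    by congr c; ring.
  exists (d + n)%N => [|q qA]; first by rewrite addn_gt0 d0 leq_add.
  have yL : x + q.[d%:R] \in L.
    rewrite mem_cat; apply/orP; right; apply: allpairs_f => //.
    by apply: allpairs_f => //; rewrite mem_iota ltnS.
  rewrite -(cd q) // -(eqc q d) // horner_derived -natrD addnC.
  by congr c; ring.
exists (s + x - p.[n%:R]).
  rewrite mem_cat; apply/orP; right; apply: allpairs_f; first exact: allpairs_f.
  by apply/mapP; exists n => //; rewrite mem_iota ltnS.
have [cC|cC] := boolP (c (s + x - p.[n%:R]) \in c (s + x) |: C).
  by left; apply: focus'.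
by right; exists (c (s + x) |: C); split=> //; rewrite cardsU1 cxC rC.
Qed.

Lemma vdw_of_derived p A : (forall q, q \in A -> q.[0] = 0) ->
  (forall M, vdw (derived_family p A M)) -> vdw A.
Proof.
move=> A0 vdwA' K; have [F [N FN]] := color_focusing A0 vdwA' K #|K|.
exists F, N => c; have [x xF [mono|[C [cardC cxC _]]]] := FN c; first by exists x.
by have := max_card (c x |: C); rewrite cardsU1 cxC cardC ltnn.
Qed.

Lemma vdw_nonzero A : vdw [seq q <- A | q != 0] -> vdw A.
Proof.
move=> vdwA K; have [F [N FN]] := vdwA K; exists F, N => c.
have [x xF [n nN mono]] := FN c; exists x => //; exists n => // q qA.
have [->|q0] := eqVneq q 0; first by rewrite horner0 addr0.
by apply: mono; rewrite mem_filter q0.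
Qed.

Lemma vdw_nil : vdw [::].
Proof.
move=> K; exists [:: 0], 1%N => c; exists 0; first by rewrite inE.
by exists 1%N.
Qed.

(** Shifting the variable preserves the leading term, over any ring. *)
Lemma size_shift_sub p (d : R) : p != 0 ->
  (size (p \Po ('X + d%:P) - p)%R < size p)%N.
Proof.
elim/poly_ind: p => [|p c IH]; first by rewrite eqxx.
move=> pXc0; have [p0|p0] := eqVneq p 0.
  move: pXc0; rewrite p0 mul0r add0r comp_polyC subrr size_poly0 => ?.
  by rewrite lt0n size_poly_eq0.
have -> : (p * 'X + c%:P) \Po ('X + d%:P) - (p * 'X + c%:P) =
    (p \Po ('X + d%:P) - p) * 'X + d *: (p \Po ('X + d%:P)).
  rewrite comp_polyD comp_polyM comp_polyX comp_polyC -mul_polyC; ring.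
rewrite size_MXaddC (negPf p0) /= ltnS (leq_trans (size_polyD _ _)) // geq_max.
apply/andP; split.
  by rewrite (leq_trans (size_polyMleq _ _)) // size_polyX addn2 /= IH.
rewrite (leq_trans (size_scale_leq _ _)) // (leq_trans (size_comp_poly_leq _ _)) //.
by rewrite size_XaddC /= muln1 prednK // lt0n size_poly_eq0.
Qed.

(** Up to terms of degree < deg q, passing from q to its derived polynomial just
subtracts p. *)
Lemma derived_coef p q d : q.[0] = 0 -> q != 0 -> (size p <= size q)%N ->
  (size (derived p q d) <= size q)%N /\
  (derived p q d)`_(size q).-1 = lead_coef q - p`_(size q).-1.
Proof.
move=> qz q0 pq.
pose e := (q \Po ('X + d%:R%:P) - q) - q.[d%:R]%:P.
have qgt0 : (0 < size q)%N by rewrite lt0n size_poly_eq0.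
have qgt1 : (1 < size q)%N.
  rewrite ltnNge; apply/negP => /size1_polyC qC; move: qz q0.
  by rewrite qC hornerC => ->; rewrite eqxx.
have le_e : (size e < size q)%N.
  apply: leq_ltn_trans (size_polyD _ _) _; rewrite size_polyN gtn_max.
  by rewrite size_shift_sub //= (leq_ltn_trans (size_polyC_leq1 _)).
have -> : derived p q d = q - p + e by rewrite /derived /e; ring.
split.
  apply: leq_trans (size_polyD _ _) _; rewrite geq_max (ltnW le_e) andbT.
  by apply: leq_trans (size_polyD _ _) _; rewrite size_polyN geq_max leqnn.
by rewrite coefD coefB (nth_default 0 (_ : size e <= _)%N) ?addr0 // -ltnS prednK.
Qed.

(** Two polynomials of the same degree are equivalent in the PET sense when their
difference has smaller degree, that is, when their leading coefficients agree:
leads A s lists the classes of the polynomials of degree s - 1. *)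
Definition leads A (s : nat) : seq R :=
  undup [seq lead_coef q | q <- A & size q == s].

Definition weight A (s : nat) : nat := size (leads A s).

Lemma mem_leads A q : q \in A -> lead_coef q \in leads A (size q).
Proof. by move=> qA; rewrite mem_undup map_f // mem_filter eqxx. Qed.

(** Above the degree of p, subtracting p does not affect the leading terms. *)
Lemma weight_derived_gt p A M s : (forall q, q \in A -> q.[0] = 0 /\ q != 0) ->
  (forall q, q \in A -> (size p <= size q)%N) -> (size p < s)%N ->
  (weight (derived_family p A M) s <= weight A s)%N.
Proof.
move=> A0 pmin ps; apply: uniq_leq_size; first exact: undup_uniq.
move=> l; rewrite mem_undup => /mapP[g].
rewrite mem_filter => /andP[/eqP gs /allpairsP[[q d] /= [qA _ gE]] ->].
have [qz q0] := A0 q qA; have [gq] := derived_coef d qz q0 (pmin q qA).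
rewrite -gE {gE} in gq * => coefg; rewrite gs in gq.
have qgt0 : (0 < size q)%N by rewrite lt0n size_poly_eq0.
rewrite (nth_default 0 (_ : size p <= _)%N) ?subr0 in coefg; last first.
  by rewrite -ltnS prednK // (leq_trans ps).
have sq : size q = s.
  apply/eqP; rewrite eqn_leq gq andbT -gs -(prednK qgt0) ltnNge; apply/negP => le_g.
  by move: coefg q0; rewrite nth_default // => /esym/eqP; rewrite lead_coef_eq0 => ->.
by rewrite -sq lead_coefE gs -sq coefg mem_leads.
Qed.

(** In the degree of p, subtracting p subtracts the leading coefficient of p from
all the others, and the class of p itself falls to a smaller degree. *)
Lemma weight_derived_lt p A M : (forall q, q \in A -> q.[0] = 0 /\ q != 0) ->
  (forall q, q \in A -> (size p <= size q)%N) -> p \in A ->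
  (weight (derived_family p A M) (size p) < weight A (size p))%N.
Proof.
move=> A0 pmin pA; have pl := mem_leads pA; have [_ p0] := A0 p pA.
have -> : weight A (size p) =
    (size [seq l - lead_coef p | l <- rem (lead_coef p) (leads A (size p))]).+1.
  by rewrite size_map size_rem // prednK // /weight; case: leads pl.
rewrite ltnS; apply: uniq_leq_size; first exact: undup_uniq.
move=> l; rewrite mem_undup => /mapP[g].
rewrite mem_filter => /andP[/eqP gs /allpairsP[[q d] /= [qA _ gE]] ->].
have [qz q0] := A0 q qA; have [gq] := derived_coef d qz q0 (pmin q qA).
rewrite -gE {gE} in gq * => coefg; rewrite gs in gq.
have qgt0 : (0 < size q)%N by rewrite lt0n size_poly_eq0.
have sq : size q = size p.
  apply/eqP; rewrite eqn_leq gq andbT leqNgt; apply/negP => ltpq.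
  have ple : (size p <= (size q).-1)%N by rewrite -ltnS prednK.
  move: coefg q0; rewrite !nth_default ?gs // subr0 => /esym/eqP.
  by rewrite lead_coef_eq0 => ->.
rewrite sq -lead_coefE -gs -lead_coefE in coefg.
rewrite coefg; apply/mapP; exists (lead_coef q) => //.
rewrite mem_rem_uniq ?undup_uniq // inE -sq mem_leads // andbT.
apply: contra_neq p0 => eql; move: coefg; rewrite eql subrr => /eqP.
by rewrite lead_coef_eq0 -size_poly_eq0 gs size_poly_eq0 => /eqP.
Qed.

Lemma weight_filter (P : pred {poly R}) A s :
  (weight [seq q <- A | P q] s <= weight A s)%N.
Proof.
apply: uniq_leq_size; first exact: undup_uniq.
move=> l; rewrite !mem_undup => /mapP[g]; rewrite !mem_filter => /and3P[gs _ gA] ->.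
by rewrite map_f // mem_filter gs.
Qed.

(** PET induction on the weights of A, with p of minimal degree in A. The zero
polynomial imposes no condition, but its derived polynomial -p would add a
class in the degree of p, so it is discarded first. *)
Theorem polynomial_vdw A : (forall q, q \in A -> q.[0] = 0) -> vdw A.
Proof.
have [D] : exists D, forall q, q \in A -> (size q < D)%N.
  exists (\max_(q <- A) size q).+1 => q qA; rewrite ltnS.
  exact: leq_bigmax_seq.
have [w] : exists w, w = weight A by exists (weight A).
elim/(dominance_ind (D := D)): w A => w IH A wE AD A0.
apply: vdw_nonzero; set B := [seq _ <- _ | _].
have [B0|B0] := eqVneq B [::]; first by rewrite B0; apply: vdw_nil.
have B1 q : q \in B -> q.[0] = 0 /\ q != 0.
  by rewrite mem_filter => /andP[? /A0].
have BD q : q \in B -> (size q < D)%N by rewrite mem_filter => /andP[_ /AD].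
have exs : exists s, has (fun q => size q == s) B.
  by case: B B0 {B1 BD} => // q B' _; exists (size q); rewrite /= eqxx.
have [s /hasP[p pB /eqP <-{s}] smin] := ex_minnP exs.
have pmin q : q \in B -> (size p <= size q)%N.
  by move=> qB; apply: smin; apply/hasP; exists q.
apply: (@vdw_of_derived p) => [q /B1[] //|M].
apply: (IH (weight (derived_family p B M))) => //.
- exists (size p); first exact: BD.
  split=> [|i /andP[pi _]]; rewrite wE.
    exact: leq_trans (weight_derived_lt M B1 pmin pB) (weight_filter _ _ _).
  exact: leq_trans (weight_derived_gt M B1 pmin pi) (weight_filter _ _ _).
- move=> g /allpairsP[[q d] /= [qB _ ->]]; have [qz q0] := B1 q qB.
  by apply: leq_ltn_trans (BD q qB); have [] := derived_coef d qz q0 (pmin q qB).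
- move=> g /allpairsP[[q d] /= [qB _ ->]].
  by rewrite horner_derived add0r subrr sub0r (proj1 (B1 p pB)) oppr0.
Qed.

End PolynomialVdW.

(** * Piecewise syndetic sets *)

(** If no translate of H were contained in T, then H itself would witness that
the complement of T is syndetic, and T could not meet it. *)
Lemma thick_translate (k : nat) (T : set 'rV[int]_k) (H : seq 'rV[int]_k) :
  thick T -> (forall h, h \in H -> Npow k h) ->
  exists2 g, Npow k g & forall h, h \in H -> T (h + g).
Proof.
move=> [TN Tthick] HN; apply: contrapT => noshift.
have [|x [Tx [_ /(_ Tx)]] //] := Tthick (Npow k `\` T).
split; first by move=> x [].
exists [set` H]; split; [exact: finite_seq|by move=> h /HN|move=> g gN].
apply: contrapT => allT; apply: noshift; exists g => // h hH.
apply: contrapT => nT; apply: allT; exists h => //; split=> // i.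
by rewrite mxE addr_gt0 //; apply: HN.
Qed.

Lemma exists_Npow_shift (k : nat) (P : seq 'rV[int]_k) :
  exists u, forall y, y \in P -> Npow k (y + u).
Proof.
exists (\row_i (1 + \sum_(y <- P) `|y 0 i|)) => y yP i; rewrite !mxE.
have y_le : 0 <= y 0 i + `|y 0 i|.
  by rewrite addrC -lerBlDr sub0r -normrN ler_norm.
have -> : y 0 i + (1 + \sum_(z <- P) `|z 0 i|) =
    1 + (y 0 i + `|y 0 i| + \sum_(z <- rem y P) `|z 0 i|).
  by rewrite (big_rem y) //=; ring.
by rewrite ltr_pwDl // addr_ge0 // sumr_ge0.
Qed.

(** F comes from the syndetic part and v from the thick part. That F is chosen
before P makes the number of colours independent of the configurations to be
coloured. *)
Lemma piecewise_syndetic_cover (k : nat) (A : set 'rV[int]_k) :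
  piecewise_syndetic A ->
  exists F : seq 'rV[int]_k, forall P : seq 'rV[int]_k,
  exists v, forall y, y \in P ->
  exists2 f, f \in F & Npow k (f + (y + v)) /\ A (f + (y + v)).
Proof.
move=> [S [T [[SN [F [/finite_seqP[H ->] HN HS]]] Tthick ->]]].
exists H => P; have [u uP] := exists_Npow_shift P.
have [|g gN gT] := @thick_translate _ _ [seq f + (y + u) | f <- H, y <- P] Tthick.
  move=> _ /allpairsP[[f y] /= [fH yP ->]] i; rewrite mxE addr_gt0 //.
    exact: HN.
  exact: uP.
exists (u + g) => y yP.
have [|f fH Sf] := HS (y + (u + g)).
  by move=> i; rewrite addrA mxE addr_gt0 //; apply: uP.
exists f => //; split; first exact: SN.
by split=> //; rewrite !addrA -(addrA f y); apply: gT; apply: allpairs_f.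
Qed.

(** The coefficient of order i in the one of order j of an element of
{poly {poly int}} is its i-th coordinate in the j-th copy of Z^k; in particular
'X^i *: 'X^j is the basis vector e_(j,i). *)
Lemma polynomial_config_piecewise_syndetic (k t : nat)
    (A : 'I_t -> set 'rV[int]_k) (a : 'I_t -> 'I_k -> {poly int}) :
  (forall j, piecewise_syndetic (A j)) -> (forall j i, (a j i).[0] = 0) ->
  exists2 n : nat, (0 < n)%N & forall j, exists2 x, Npow k x &
    forall i, A j (x + (a j i).[n%:R] *: delta_mx 0 i).
Proof.
move=> pwA a0.
have /choice[F FP] : forall j, exists F, _ :=
  fun j => piecewise_syndetic_cover (pwA j).
pose pi (j : 'I_t) (y : {poly {poly int}}) : 'rV[int]_k := \row_i y`_j`_i.
have piD j y z : pi j (y + z) = pi j y + pi j z.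
  by apply/rowP => i; rewrite !mxE !coefD.
pose q (i : 'I_k) : {poly {poly {poly int}}} :=
  \sum_(j < t) map_poly intr (a j i) * ('X^i *: 'X^j)%:P.
have q_int i (n : int) :
    (q i).[n%:~R] = \sum_(j < t) (a j i).[n]%:~R * ('X^i *: 'X^j).
  rewrite horner_sum; apply: eq_bigr => j _.
  by rewrite hornerM hornerC horner_map.
have pi_q j i (n : nat) : pi j (q i).[n%:R] = (a j i).[n%:R] *: delta_mx 0 i.
  rewrite -mulrz_nat q_int; apply/rowP => l; rewrite !mxE !coef_sum.
  rewrite (bigD1 j) //= big1 ?addr0.
    rewrite mulrzl coefMrz coefZ coefXn eqxx mulr1 coefMrz coefXn.
by rewrite mulrzz mulrC.
  move=> h hj; have jh : (val j == val h) = false.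
    by apply: negbTE; rewrite eq_sym.
  by rewrite mulrzl coefMrz coefZ coefXn jh mulr0 mul0rz coef0.
pose M := \max_j size (F j).
have [|H [N HN]] := @polynomial_vdw _ (codom q) _ {ffun 'I_t -> 'I_M.+1}.
  move=> _ /codomP[i ->]; have := q_int i 0; rewrite mulr0z => ->.
  by rewrite big1 // => j _; rewrite a0 mul0r.
(* All the base points, and all the points of the configurations at them. *)
pose pts := H ++ [seq x + y | x <- H,
  y <- [seq (q i).[n%:R] | i <- enum 'I_k, n <- iota 0 N.+1]].
have /choice[v vP] : forall j, exists v, _ := fun j => FP j (map (pi j) pts).
pose good j y f := Npow k (f + (pi j y + v j)) /\ A j (f + (pi j y + v j)).
pose col j y := find (fun f => `[< good j y f >]) (F j).
have colP j y : y \in pts -> (col j y < size (F j))%N /\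
    good j y (F j)`_(col j y).
  move=> ypts; have [|f fF fA] := vP j (pi j y); first exact: map_f.
  have hasf : has (fun f => `[< good j y f >]) (F j).
    by apply/hasP; exists f => //; apply/asboolP.
  by split; [rewrite -has_find|apply/asboolP; exact: (nth_find 0 hasf)].
have [x xH [n /andP[n0 nN] mono]] := HN (fun y => [ffun j => inord (col j y)]).
exists n => // j; have xpts : x \in pts by rewrite mem_cat xH.
have [colx [fN _]] := colP j x xpts.
exists ((F j)`_(col j x) + (pi j x + v j)) => // i.
have ypts : x + (q i).[n%:R] \in pts.
  rewrite mem_cat; apply/orP; right; apply: allpairs_f => //.
  by apply: allpairs_f; rewrite ?mem_enum // mem_iota ltnS.
have [coly [_ Ay]] := colP j _ ypts.
have := congr1 (fun g : {ffun _ -> _} => val (g j)) (mono (q i) (codom_f _ _)).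
have ltM l : (l < size (F j))%N -> (l < M.+1)%N.
  move=> lF; rewrite ltnS ltnW // (leq_trans lF) //.
  exact: (leq_bigmax (F := fun j => size (F j))).
rewrite !ffunE /= !inordK ?ltM // => eqcol.
by move: Ay; rewrite eqcol piD pi_q addrAC !addrA.
Qed.

(** * Reduction to perfect powers *)

Lemma floor_horner_root (R : realType) (p : {poly int}) (m n : nat) :
  (0 < m)%N -> Num.floor (map_poly intr p).[((n ^ m)%:R : R) `^ m%:R^-1] =
  p.[n%:R].
Proof.
move=> m0; rewrite natrX -powR_mulrn // -powRrM mulfV ?powRr1 //.
  by rewrite -mulrz_nat horner_map /= intrKfloor.
by rewrite pnatr_eq0 -lt0n.
Qed.

Theorem corollary8p13 (R : realType) (k t m : nat)
    (hk : (0 < k)%N) (ht : (0 < t)%N) (hm : (0 < m)%N)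
    (A : 'I_t -> set 'rV[int]_k)
    (hA : forall j, piecewise_syndetic (A j))
    (a : 'I_t -> 'I_k -> {poly int})
    (ha : forall j i, (a j i).[0] = 0)
    (b : 'I_t -> 'I_k -> nat -> int)
    (hb : forall j i n, (0 < n)%N ->
      b j i n = Num.floor (map_poly intr (a j i)).[(n%:R : R) `^ m%:R^-1]) :
  exists n : nat, (0 < n)%N /\
    forall j, exists2 x, Npow k x &
      [set x + b j i n *: delta_mx 0 i | i in [set: 'I_k]] `<=` A j.
Proof.
have [r r0 rA] := polynomial_config_piecewise_syndetic hA ha.
have rm0 : (0 < r ^ m)%N by rewrite expn_gt0 r0.
exists (r ^ m)%N; split=> // j; have [x xN xA] := rA j.
exists x => // _ [i _ <-]; rewrite hb // floor_horner_root //; exact: xA.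
Qed.
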